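(* Consider the six-quark NJL model of top-quark condensation with factorized couplings described in the context, in the vacuum with diagonal condensates and quark masses $M_q>0$, $q\in\{u,d,c,s,t,b\}$, pairwise distinct (so that the $\delta y_q$ are pairwise distinct). Boson masses are computed in the one-loop, leading-logarithmic approximation, to leading order in the $\delta y$'s, as specified in the context. Then: (1) In each channel $q\bar q$, $q\in\{u,d,c,s,t,b\}$, there are two excitations, a pseudoscalar and a scalar, with masses $$M^P_{q\bar q}=0,\qquad M^S_{q\bar q}=2M_q .$$ (2) In each channel formed by two different quarks $q_1\neq q_2\in\{u,d,c,s,t,b\}$ there are four excitations, namely two doubly degenerate ones, with squared masses $$M_{q_1q_2}^2=M_{q_1}^2+M_{q_2}^2\pm\sqrt{\bigl(M_{q_2}^2-M_{q_1}^2\bigr)^2\zeta_{q_1q_2}^2+4M_{q_1}^2M_{q_2}^2},$$ where $$\zeta_{q_1q_2}=\frac{2\,\delta y_{q_1q_2}-\delta y_{q_2}-\delta y_{q_1}}{\delta y_{q_1}-\delta y_{q_2}}=\zeta_{q_2q_1}.$$ (3) The Nambu sum rule holds in this approximation: $$[M^{+}_{q_1\bar q_2}]^2+[M^{-}_{q_1\bar q_2}]^2+[M^{+}_{q_2\bar q_1}]^2+[M^{-}_{q_2\bar q_1}]^2= 4\,[M_{q_1}^2+M_{q_2}^2]\quad(q_1\ne q_2),\qquad [M^P_{q\bar q}]^2+[M^S_{q\bar q}]^2= 4M_q^2,$$ where the left side of the first relation is the sum of the squared masses of all four excitations of the channel in (2), counted with multiplicity.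
   Context: Model. Quarks form doublets $(u,d),(c,s),(t,b)$ (three generations), $N_C$ colors ($N_C=3$). The Lagrangian is $\bar\chi\, i\gamma\partial\,\chi$ plus a four-fermion term of strength $g$, $(\bar\chi_{L}\chi_R)(\bar\chi_R\chi_L)$, whose coupling tensor is $YY^+$ with $Y$ factorized as (a Hermitian $3\times3$ matrix $L$ on left generation indices)$\,\otimes\,$(a Hermitian $3\times 3$ matrix $R$ on right generation indices)$\,\otimes\,$(a Hermitian $2\times2$ matrix $I$ on the right up/down index). After diagonalization, $L=\mathrm{diag}(L_{ud},L_{cs},L_{tb})$, $R=\mathrm{diag}(R_{ud},R_{cs},R_{tb})$, $I=\mathrm{diag}(I_{up},I_{down})$. For quarks $q_1,q_2$ set $y_{q_1q_2}=L_{\mathrm{gen}(q_1)}R_{\mathrm{gen}(q_2)}I_{\mathrm{type}(q_2)}$ and $y_q=y_{qq}$, where $\mathrm{gen}$ is the generation and $\mathrm{type}\in\{up,down\}$. Write $y_q=1+\delta y_q$, $y_{q_1q_2}=1+\delta y_{q_1q_2}$ with $|\delta y|\ll1$; to first order $\delta y_{q_1q_2}+\delta y_{q_2q_1}=\delta y_{q_1}+\delta y_{q_2}$. Loop integrals and gap equation (Minkowski signature, cutoff $\Lambda\gg M_q$): $$T(m)=\frac{i}{(2\pi)^4}\int\frac{d^4l}{l^2-m^2},\qquad I(m_1,m_2,p)=\frac{i}{(2\pi)^4}\int\frac{d^4l}{(l^2-m_1^2)[(p-l)^2-m_2^2]}.$$ Shifts of the integration variable are allowed, so $\frac{i}{(2\pi)^4}\int\frac{d^4l}{(p-l)^2-m^2}$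 is identified with $T(m)$; one has $T(m_1)-T(m_2)=(m_1^2-m_2^2)I(m_1,m_2,0)$. The quark masses satisfy the gap equations $$\frac1{gN_C}=2y_q^2\,T(M_q)\quad\text{for all }q .$$ Polarization operators ($p=(E,0,0,0)$, $p^2=E^2$, $\mathrm{Sp}$ = trace over Dirac indices). In the channel $q\bar q$: $$\Pi^S_{q\bar q}=-\frac{i y_q^2}{2(2\pi)^4}\int d^4l\,\mathrm{Sp}\frac1{l\gamma-M_q}\frac1{(p-l)\gamma-M_q},$$ $$\Pi^P_{q\bar q}=-\frac{i y_q^2}{2(2\pi)^4}\int d^4l\,\mathrm{Sp}\, i\gamma^5\frac1{l\gamma-M_q}i\gamma^5\frac1{(p-l)\gamma-M_q}.$$ For $q_1\neq q_2$ the polarization operator is the $2\times 2$ matrix $\mathcal P_{q_1q_2}$ acting on the pair of complex fields $(q_{1,L}\bar q_{2,R},\;q_{2,L}\bar q_{1,R})$, with diagonal entries $$-\frac{i y_{q_1q_2}^2}{4(2\pi)^4}\int d^4l\,\mathrm{Sp}\frac1{l\gamma-M_{q_1}}(1\pm\gamma^5)\frac1{(p-l)\gamma-M_{q_2}}(1\mp\gamma^5)$$ and the same with $q_1\leftrightarrow q_2$, and both off-diagonal entries equal to $$-\frac{i y_{q_1q_2}y_{q_2q_1}}{4(2\pi)^4}\int d^4l\,\mathrm{Sp}\frac1{l\gamma-M_{q_1}}(1\pm\gamma^5)\frac1{(p-l)\gamma-M_{q_2}}(1\pm\gamma^5).$$ The parameter $\zeta_{q_1q_2}$ is defined by $$\frac1{y_{q_1q_2}^2}=\frac{1+\zeta_{q_1q_2}}{2y_{q_1}^2}+\frac{1-\zeta_{q_1q_2}}{2y_{q_2}^2},$$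 taken to leading order in the $\delta y$'s, i.e. $2\delta y_{q_1q_2}=(1+\zeta_{q_1q_2})\delta y_{q_1}+(1-\zeta_{q_1q_2})\delta y_{q_2}$. Approximation and definition of masses. After reduction to $T$ and $I$, the leading-logarithmic approximation ($\Lambda\gg M_q$) replaces each $I(M_{q_1},M_{q_2},p)$ by a nonzero constant independent of $p$ (of modulus $\frac1{16\pi^2}\log(\Lambda^2/M_{q_1}^2)$ with $M_{q_1}\ge M_{q_2}$). The masses are the values $E$ (equivalently, squared masses are the values $E^2$) at which $\frac1{gN_C}-\Pi^{S}_{q\bar q}=0$, respectively $\frac1{gN_C}-\Pi^{P}_{q\bar q}=0$, respectively $\det\bigl(\frac1{gN_C}-\mathcal P_{q_1q_2}\bigr)=0$. Since the fields in the mixed channels are complex, each root $E^2$ of the determinant corresponds to two real excitations (double degeneracy).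
   Formalization: The printed operators for the q q̄ channels give M^S=0 and M^P=2M_q, exchanging scalar and pseudoscalar; here the antiquark line is 1/((p−l)γ+M_q) in place of 1/((p−l)γ−M_q), which restores claim (1). *)

(* Defs.v *)
From HB Require Import structures.
From mathcomp Require Import all_boot all_order all_algebra.
From mathcomp Require Import all_classical all_reals all_analysis.
From mathcomp Require Import fraction complex.
From mathcomp Require mpoly.
(* mpoly's notations clash with those of MathComp-Analysis. *)
Export (canonicals) mpoly.

Set Implicit Arguments.
Unset Strict Implicit.
Unset Printing Implicit Defensive.

Import Order.TTheory GRing.Theory Num.Theory.
Import numFieldNormedType.Exports.

Local Open Scope classical_set_scope.
Local Open Scope ring_scope.
Local Open Scope complex_scope.

(* Generation (0 = ud, 1 = cs, 2 = tb) and position in the doublet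
   (true = up, false = down). *)
Definition quark : Type := ('I_3 * bool)%type.
Definition gen (q : quark) : 'I_3 := q.1.
Definition is_up (q : quark) : bool := q.2.

Definition NC : nat := 3.

(* Integrands of the loop integrals: rational functions, with complex
   coefficients, of the components l^0, ..., l^3 of the loop momentum. *)
Notation integrand R := {fraction (mpoly.mpoly 4 R[i])}.

(* The couplings L, R, I after diagonalization, the four-fermion strength g,
   and a regularized "f |-> int d^4 l f". The integrals diverge, so the
   regularization is a parameter; [leading_log] below lists the rules of
   calculation it obeys. *)
Record njl (R : realType) := NJL {
  cL : 'I_3 -> R;
  cR : 'I_3 -> R;
  cI : bool -> R;
  cg : R;
  loop_integral : integrand R -> R[i]
}.

Section Kinematics.
Variable R : realType.
Local Notation C := R[i].
Local Notation K := (integrand R).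

Definition cst (a : C) : K := tofrac (mpoly.mpolyC 4 a).
Definition loop_mom : 'I_4 -> K :=
  fun mu => tofrac (mpoly.mpolyX C (mpoly.mnm1 mu)).

(* p = (E, 0, 0, 0). The energy ranges over C because E^2 may be negative. *)
Definition ext_mom (E : C) : 'I_4 -> K :=
  fun mu => if mu == ord0 then cst E else 0.

Definition metric {A : pzRingType} (mu : 'I_4) : A :=
  if mu == ord0 then 1 else -1.

Definition msq (k : 'I_4 -> K) : K := \sum_mu metric mu * k mu ^+ 2.

Definition dirac_matrices (gamma : 'I_4 -> 'M[C]_4) : Prop :=
  forall mu nu : 'I_4,
    gamma mu *m gamma nu + gamma nu *m gamma mu
      = (if mu == nu then 2 * metric mu else 0)%:M.

Definition gamma5 (gamma : 'I_4 -> 'M[C]_4) : 'M[C]_4 :=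
  'i *: \big[mulmx/1%:M]_(mu < 4) gamma mu.

Variable gamma : 'I_4 -> 'M[C]_4.

Definition vertex (A : 'M[C]_4) : 'M[K]_4 := map_mx cst A.

Definition slash (k : 'I_4 -> K) : 'M[K]_4 :=
  \sum_mu (metric mu * k mu) *: vertex (gamma mu).

(* 1 / (k gamma - m) *)
Definition propagator (k : 'I_4 -> K) (m : R) : 'M[K]_4 :=
  invmx (slash k - (cst m%:C)%:M).

End Kinematics.

Section LoopIntegrals.
Variables (R : realType) (X : njl R).
Local Notation C := R[i].
Local Notation "'int' f" := (@loop_integral R X f) (at level 10, f at level 8).
Local Notation l := (@loop_mom R).

Definition loop_norm : C := 'i / ((2 * pi) ^+ 4)%:C.

Definition Tint (m : R) : C :=
  loop_norm * int ((msq l - cst (m ^+ 2)%:C)^-1).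

Definition Iint (m1 m2 : R) (E : C) : C :=
  loop_norm * int (((msq l - cst (m1 ^+ 2)%:C) *
                    (msq (ext_mom E \- l) - cst (m2 ^+ 2)%:C))^-1).

(* Linearity, invariance of the tadpole under shifts of the integration
   variable, and the leading-logarithmic replacement of I by a constant
   independent of p. Of this constant only nonvanishing is required. *)
Definition leading_log (M : quark -> R) : Prop :=
  [/\ forall (a : C) f1 f2, int (cst a * f1 + f2) = a * int f1 + int f2,
      forall (m : R) (E : C),
        loop_norm * int ((msq (ext_mom E \- l) - cst (m ^+ 2)%:C)^-1)
          = Tint m
    & forall q1 q2, exists2 c : C, c != 0 &
        forall E : C, Iint (M q1) (M q2) E = c].

End LoopIntegrals.

Section Channels.
Variables (R : realType) (gamma : 'I_4 -> 'M[R[i]]_4).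
Variables (M : quark -> R) (X : njl R).
Local Notation C := R[i].
Local Notation "'int' f" := (@loop_integral R X f) (at level 10, f at level 8).
Local Notation l := (@loop_mom R).
Local Notation S := (propagator gamma).
Local Notation g5 := (gamma5 gamma).

Definition y (q1 q2 : quark) : R :=
  cL X (gen q1) * cR X (gen q2) * cI X (is_up q2).

Definition inv_gNC : C := (1 / (cg X * NC%:R))%:C.

Definition vacuum : Prop :=
  [/\ cg X != 0,
      leading_log X M
    & forall q, inv_gNC = 2 * (y q q ^+ 2)%:C * Tint X (M q)].

(* In the q qbar channel the antiquark line is
     1/((p-l)gamma + M_q) = - 1/((l-p)gamma - M_q).
   Writing 1/((p-l)gamma - M_q) instead would exchange the scalar and the
   pseudoscalar operators, because
     gamma5 (1/(k gamma - M)) gamma5 = - 1/(k gamma + M). *)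
Definition Pi_S (q : quark) (E : C) : C :=
  - ('i * (y q q ^+ 2)%:C / (2 * ((2 * pi) ^+ 4)%:C)) *
    int (\tr (S l (M q) *m S (ext_mom E \- l) (- M q))).

Definition Pi_P (q : quark) (E : C) : C :=
  - ('i * (y q q ^+ 2)%:C / (2 * ((2 * pi) ^+ 4)%:C)) *
    int (\tr (vertex ('i *: g5) *m S l (M q) *m
              vertex ('i *: g5) *m S (ext_mom E \- l) (- M q))).

(* For b = false, true: 1 + gamma5, 1 - gamma5. *)
Definition chiral (b : bool) : 'M[integrand R]_4 :=
  vertex (1%:M + (-1) ^+ b *: g5).

Definition mixed_diag (b : bool) (q1 q2 : quark) (E : C) : C :=
  - ('i * (y q1 q2 ^+ 2)%:C / (4 * ((2 * pi) ^+ 4)%:C)) *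
    int (\tr (S l (M q1) *m chiral b *m
              S (ext_mom E \- l) (M q2) *m chiral (~~ b))).

(* Changing the sign of the mass in the antiquark line changes the sign of
   the off-diagonal entries only, hence not the determinant. *)
Definition mixed_off (b : bool) (q1 q2 : quark) (E : C) : C :=
  - ('i * (y q1 q2 * y q2 q1)%:C / (4 * ((2 * pi) ^+ 4)%:C)) *
    int (\tr (S l (M q1) *m chiral b *m
              S (ext_mom E \- l) (M q2) *m chiral b)).

(* [sgn i j] is the choice of upper or lower sign in the entry (i, j). *)
Definition mixed_op (sgn : 'I_2 -> 'I_2 -> bool) (q1 q2 : quark) (E : C) :
    'M[C]_2 :=
  \matrix_(i, j)
    if i != j then mixed_off (sgn i j) q1 q2 E
    else if i == ord0 then mixed_diag (sgn i j) q1 q2 E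
    else mixed_diag (sgn i j) q2 q1 E.

Definition disp_S (q : quark) (E : C) : C := inv_gNC - Pi_S q E.
Definition disp_P (q : quark) (E : C) : C := inv_gNC - Pi_P q E.
Definition disp_mixed sgn (q1 q2 : quark) (E : C) : C :=
  \det (inv_gNC%:M - mixed_op sgn q1 q2 E).

(* z is the exact parameter zeta_{q1 q2} of the model X. *)
Definition is_zeta (q1 q2 : quark) (z : R) : Prop :=
  1 / y q1 q2 ^+ 2
    = (1 + z) / (2 * y q1 q1 ^+ 2) + (1 - z) / (2 * y q2 q2 ^+ 2).

End Channels.

Section Spectra.
Variable R : realType.
Local Notation C := R[i].

(* The dispersion function D describes one real excitation, of mass m. *)
Definition has_mass (D : C -> C) (m : R) : Prop :=
  0 <= m /\ forall E : C, D E = 0 <-> E ^+ 2 = (m ^+ 2)%:C.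

(* "Leading order in the delta y" is the limit e -> 0+ along a family of
   models with delta y = O(e). For small e the roots E^2 of D e are the real
   numbers x i e, each listed once, and s lists their limits; limits may
   coincide. *)
Definition leading_roots (D : R -> C -> C) (s : seq R) : Prop :=
  exists2 x : 'I_(size s) -> R -> R,
    (\forall e \near 0^'+,
       injective (x^~ e) /\
       forall E : C, D e E = 0 <-> exists i, E ^+ 2 = (x i e)%:C) &
    forall i, x i e @[e --> 0^'+] --> s`_i.

(* In a channel of complex fields each root stands for two real excitations;
   ms lists the squared masses of all excitations to leading order. *)
Definition complex_excitations (D : R -> C -> C) (ms : seq R) : Prop :=
  exists2 s : seq R, leading_roots D s & perm_eq ms (s ++ s).

(* zeta_{q1 q2} to leading order, dy being the first-order coefficients of
   the delta y. *)
Definition zeta_lead (dy : quark -> quark -> R) (q1 q2 : quark) : R :=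
  (2 * dy q1 q2 - dy q2 q2 - dy q1 q1) / (dy q1 q1 - dy q2 q2).

End Spectra.

(* Main.v *)
Require Import Defs.
From HB Require Import structures.
From mathcomp Require Import all_boot all_order all_algebra.
From mathcomp Require Import all_classical all_reals all_analysis.
From mathcomp Require Import fraction complex.
From mathcomp Require Import ring lra.

(* Reducing the Dirac traces by 2 l.(p - l) = p^2 - l^2 - (p - l)^2 and using the
   gap equation, one finds, with T_i the tadpoles and c the constant value of I,
     1/(g N_C) - Pi^S = y_q^2 (E^2 - 4 M_q^2) c,
     1/(g N_C) - Pi^P = y_q^2 E^2 c.
   In a mixed channel T_1 - T_2 = (M_1^2 - M_2^2) c, and the definition of zeta
   turns the gap equation into 1/(g N_C) = y_12^2 ((1 + zeta_12) T_1 + (1 - zeta_12) T_2).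
   Hence, with w = E^2 - M_1^2 - M_2^2 and D = M_1^2 - M_2^2, the determinant is
     (y_12 y_21 c)^2 ((w + zeta_12 D) (w - zeta_21 D) - 4 M_1^2 M_2^2),
   whose two roots E^2 are real and distinct. Finally the factorization
   y_12 y_21 = y_11 y_22 makes zeta_12 and zeta_21 have the same limit. *)

Set Implicit Arguments.
Unset Strict Implicit.
Unset Printing Implicit Defensive.

Import Order.TTheory GRing.Theory Num.Theory.
Import numFieldNormedType.Exports.

Local Open Scope classical_set_scope.
Local Open Scope ring_scope.

(** * Traces of gamma matrices *)

(** The scalar [s] carries a sign, so that commutation and anticommutation are one notion and the
    signs multiply along a product. *)
Definition scommute (K : comPzRingType) n (s : K) (A B : 'M[K]_n) : Prop :=
  A *m B = s *: (B *m A).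

Section SignedCommutation.
Variables (K : comPzRingType) (n : nat).
Implicit Types (A B C : 'M[K]_n) (s t c : K).

Lemma scommuteM s t A B C :
  scommute s A B -> scommute t A C -> scommute (s * t) A (B *m C).
Proof.
rewrite /scommute => AB AC.
by rewrite mulmxA AB -[LHS]scalemxAl -(mulmxA B A C) AC -scalemxAr scalerA mulmxA.
Qed.

Lemma scommuteZ s c A B : scommute s A B -> scommute s A (c *: B).
Proof.
rewrite /scommute => AB.
by rewrite -[LHS]scalemxAr AB -[in RHS]scalemxAl !scalerA mulrC.
Qed.

Lemma scommute_sqr s c d A B : scommute s A B -> A *m A = c%:M ->
  B *m B = d%:M -> (B *m A) *m (B *m A) = (s * c * d)%:M.
Proof.
move=> AB AA BB.
rewrite -mulmxA (mulmxA A) AB -scalemxAl -scalemxAr -mulmxA AA mul_mx_scalar.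
by rewrite -scalemxAr BB !scale_scalar_mx mulrA.
Qed.

End SignedCommutation.

(** Cyclicity gives [c * \tr A = \tr (B *m B *m A) = - \tr (B *m A *m B) = - c * \tr A]. This
    argument underlies every vanishing trace below. *)
Lemma mxtrace_anticommute (K : fieldType) n (A B : 'M[K]_n) (c : K) :
  2 != 0 :> K -> c != 0 -> B *m B = c%:M -> scommute (-1) B A -> \tr A = 0.
Proof.
rewrite /scommute scaleN1r => K2 c0 BB BA.
have h : c * \tr A = - (c * \tr A).
  rewrite -[LHS]mxtraceZ -mul_scalar_mx -BB -mulmxA BA mulmxN raddfN /=.
  by rewrite mxtrace_mulC -mulmxA BB mul_mx_scalar mxtraceZ.
have : 2 * (c * \tr A) = 0 by rewrite mulr2n mulrDl !mul1r {1}h addNr.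
by move/eqP; rewrite !mulf_eq0 (negPf K2) (negPf c0) => /eqP.
Qed.

Section Traces.
Variables (K : fieldType) (G : 'I_4 -> 'M[K]_4) (i : K).
Local Notation eta := (@Defs.metric K).
Hypotheses (K2 : 2 != 0 :> K) (ii : i ^+ 2 = -1).
Hypothesis GP : forall mu nu : 'I_4,
  G mu *m G nu + G nu *m G mu = (if mu == nu then 2 * eta mu else 0)%:M.

Local Notation G5 := (i *: \big[mulmx/1%:M]_(mu < 4) G mu).
Local Notation gslash k := (\sum_mu (eta mu * k mu) *: G mu).

Lemma metric_neq0 mu : eta mu != 0.
Proof. by rewrite /Defs.metric; case: ifP => _; rewrite ?oppr_eq0 oner_neq0. Qed.

Lemma clifford_sqr mu : G mu *m G mu = (eta mu)%:M.
Proof.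
have := GP mu mu; rewrite eqxx => h.
apply: (scalerI K2); rewrite scaler_nat mulr2n h.
by rewrite scale_scalar_mx.
Qed.

Definition csign mu nu : K := if mu == nu :> 'I_4 then 1 else -1.

Lemma clifford_scommute mu nu : scommute (csign mu nu) (G mu) (G nu).
Proof.
rewrite /scommute /csign; case: eqP => [->|/eqP mn]; first by rewrite scale1r.
by apply/eqP; rewrite scaleN1r -addr_eq0 GP (negPf mn) raddf0.
Qed.

(** The indices 1, 2, 3, in the form in which [big_ord_recl] produces them. *)
Let I1 := lift ord0 (ord0 : 'I_3).
Let I2 := lift ord0 (lift ord0 (ord0 : 'I_2)).
Let I3 := lift ord0 (lift ord0 (lift ord0 (ord0 : 'I_1))).

Lemma gamma5E : G5 = i *: (G ord0 *m G I1 *m G I2 *m G I3).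
Proof. by rewrite !big_ord_recl big_ord0 /= mulmx1 !mulmxA. Qed.

Lemma gamma5_anticommute mu : scommute (-1) (G mu) G5.
Proof.
rewrite gamma5E; apply: scommuteZ.
(* Among the four signs, the one for the factor [G mu] itself is 1 and the other three are -1. *)
rewrite (_ : -1 = csign mu ord0 * csign mu I1 * csign mu I2 * csign mu I3).
  by do 3! (apply: scommuteM; last exact: clifford_scommute);
     exact: clifford_scommute.
rewrite /csign; case: mu => [[|[|[|[|//]]]] h]; rewrite -!val_eqE /=; ring.
Qed.

(** The square is built up one factor at a time: the reorderings contribute 1 in all, the metric -1,
    and [i ^+ 2] another -1. *)
Lemma gamma5_sqr : G5 *m G5 = 1%:M.
Proof.
have c mu nu : scommute (csign mu nu) (G mu) (G nu) by exact: clifford_scommute.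
have s1 := scommute_sqr (c I1 ord0) (clifford_sqr I1) (clifford_sqr ord0).
have s2 := scommute_sqr (scommuteM (c I2 ord0) (c I2 I1)) (clifford_sqr I2) s1.
have s3 := scommute_sqr (scommuteM (scommuteM (c I3 ord0) (c I3 I1)) (c I3 I2))
  (clifford_sqr I3) s2.
rewrite gamma5E -scalemxAl -scalemxAr s3 scalerA -expr2 ii scale_scalar_mx.
congr (_%:M); rewrite /csign /Defs.metric -!val_eqE /=; ring.
Qed.

Lemma mxtrace_gamma5 : \tr G5 = 0.
Proof.
by apply: (mxtrace_anticommute K2 (metric_neq0 ord0) (clifford_sqr _));
   exact: gamma5_anticommute.
Qed.

(* Some gamma matrix differs from both factors; it commutes with their product
   and anticommutes with gamma5. *)
Lemma mxtrace_gamma2_gamma5 mu nu : \tr (G mu *m G nu *m G5) = 0.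
Proof.
have [rho rm rn] : exists2 rho, rho != mu & rho != nu.
  case: mu => [[|[|[|[|//]]]] h]; case: nu => [[|[|[|[|//]]]] h'];
  by [exists ord0 | exists I1 | exists I2].
apply: (mxtrace_anticommute K2 (metric_neq0 rho) (clifford_sqr _)).
rewrite -[-1]mul1r; apply: scommuteM; last exact: gamma5_anticommute.
rewrite (_ : 1 = csign rho mu * csign rho nu).
  by apply: scommuteM; exact: clifford_scommute.
by rewrite /csign (negPf rm) (negPf rn) mulrNN mulr1.
Qed.

Lemma slash_gamma5 k : gslash k *m G5 = - (G5 *m gslash k).
Proof.
rewrite mulmx_suml mulmx_sumr -sumrN; apply: eq_bigr => mu _.
rewrite -[LHS]scalemxAl gamma5_anticommute scaleN1r -[in RHS]scalemxAr.
by rewrite scalerN.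
Qed.

Lemma mxtrace_slash k : \tr (gslash k) = 0.
Proof.
apply: (mxtrace_anticommute K2 (oner_neq0 K) gamma5_sqr).
by rewrite /scommute slash_gamma5 scaleN1r opprK.
Qed.

Lemma mxtrace_slash_gamma5 k : \tr (gslash k *m G5) = 0.
Proof.
apply: (mxtrace_anticommute K2 (oner_neq0 K) gamma5_sqr).
by rewrite /scommute mulmxA slash_gamma5 scaleN1r mulNmx opprK.
Qed.

Lemma mxtrace_slash2_gamma5 k p : \tr (gslash k *m gslash p *m G5) = 0.
Proof.
rewrite !mulmx_suml raddf_sum big1 //= => mu _.
rewrite mulmx_sumr mulmx_suml raddf_sum big1 //= => nu _.
move: (mxtrace_gamma2_gamma5 mu nu); move: G5 => g5 h.
by rewrite -scalemxAr -!scalemxAl !mxtraceZ h !mulr0.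
Qed.

Lemma slash_anticomm k p :
  gslash k *m gslash p + gslash p *m gslash k
    = (2 * \sum_mu eta mu * (k mu * p mu))%:M.
Proof.
rewrite !mulmx_suml.
under eq_bigr do rewrite mulmx_sumr.
under [X in _ + X]eq_bigr do rewrite mulmx_sumr.
(* Once the second double sum is transposed, both have the same coefficients, so each pair [mu],
   [nu] meets a Clifford anticommutator and only the diagonal survives. *)
rewrite [X in _ + X]exchange_big -big_split /= mulr_sumr raddf_sum.
apply: eq_bigr => mu _; rewrite -big_split /=.
rewrite (bigD1 mu) //= [X in _ + X]big1 ?addr0 => [|nu nm].
  rewrite -!scalemxAr -!scalemxAl !scalerA clifford_sqr !scale_scalar_mx.
  rewrite -raddfD /=; congr (_%:M).
  have e2 : eta mu ^+ 2 = 1.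
    by rewrite /Defs.metric; case: ifP => _; rewrite ?sqrrN expr1n.
  by ring: e2.
rewrite -!scalemxAr -!scalemxAl !scalerA [in X in _ + X]mulrC -scalerDr.
by rewrite GP eq_sym (negPf nm) raddf0 scaler0.
Qed.

Lemma mxtrace_slash2 k p :
  \tr (gslash k *m gslash p) = 4 * \sum_mu eta mu * (k mu * p mu).
Proof.
have := congr1 (@mxtrace _ _) (slash_anticomm k p).
rewrite mxtrace_scalar mxtraceD [\tr (gslash p *m _)]mxtrace_mulC => h.
apply: (mulfI K2); rewrite mulr2n mulrDl !mul1r h; ring.
Qed.

Lemma slash_sqr k : gslash k *m gslash k = (\sum_mu eta mu * k mu ^+ 2)%:M.
Proof.
have := slash_anticomm k k => h.
apply: (scalerI K2); rewrite scaler_nat mulr2n h scale_scalar_mx.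
by under [in RHS]eq_bigr do rewrite expr2.
Qed.

(** Moving a vertex past [gslash p] flips its gamma5 part, whereas the mass [n] commutes with it:
    hence [a * b - u * v] with the momenta and [a * b + u * v] with the masses. Terms with a single
    slash or a leftover gamma5 have trace zero. *)
Lemma mxtrace_loop k p (m n a u b v : K) :
  \tr ((gslash k + m%:M) *m (a%:M + u *: G5) *m
       (gslash p + n%:M) *m (b%:M + v *: G5))
    = 4 * ((a * b - u * v) * (\sum_mu eta mu * (k mu * p mu))
           + (a * b + u * v) * (m * n)).
Proof.
move: gamma5_sqr mxtrace_gamma5 (slash_gamma5 p) (mxtrace_slash_gamma5 k)
  (mxtrace_slash_gamma5 p) (mxtrace_slash2_gamma5 k p).
move: (mxtrace_slash k) (mxtrace_slash p) (mxtrace_slash2 k p).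
move: G5 (gslash k) (gslash p) => g sk sp tk tp tss gg tg sg tkg tpg tssg.
have vv c w : (c%:M + w *: g) *m (b%:M + v *: g)
    = (c * b + w * v)%:M + (c * v + w * b) *: g.
  rewrite mulmxDl !mulmxDr -scalar_mxM !mul_scalar_mx !mul_mx_scalar.
  rewrite -scalemxAl -scalemxAr gg !scalerA scalemx1 [X in _ + X]addrC addrACA.
  by rewrite -raddfD -scalerDl [b * w]mulrC.
have vs c w : (c%:M + w *: g) *m sp = sp *m (c%:M - w *: g).
  rewrite mulmxDl mulmxBr mul_scalar_mx mul_mx_scalar -scalemxAl -scalemxAr.
  by rewrite sg scalerN opprK.
have VSW : (a%:M + u *: g) *m (sp + n%:M) *m (b%:M + v *: g)
    = sp *m ((a * b - u * v)%:M + (a * v - u * b) *: g)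
      + n *: ((a * b + u * v)%:M + (a * v + u * b) *: g).
  rewrite (mulmxDr _ (sp)) mulmxDl vs -scaleNr -mulmxA vv !mulNr.
  by rewrite mul_mx_scalar -scalemxAl vv.
rewrite -(mulmxA _ (a%:M + _)) -mulmxA VSW mulmxDl !mulmxDr !mul_scalar_mx.
rewrite !(mulmxDr, mul_mx_scalar, =^~ scalemxAr, mulmxA).
rewrite !(mxtraceD, mxtraceZ, mxtrace_scalar) tss ?tg ?tkg ?tpg ?tk ?tp ?tssg.
by ring.
Qed.

End Traces.

(** * Propagators over the field of rational functions of the loop momentum *)

Section LoopReduction.
Local Open Scope complex_scope.
Variable R : realType.
Local Notation C := R[i].
Local Notation K := (integrand R).
Local Notation cst := (@Defs.cst R).

HB.instance Definition _ :=
  GRing.RMorphism.copy cst (@tofrac _ \o @mpoly.mpolyC 4 C).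

Lemma integrand2_neq0 : 2 != 0 :> K.
Proof. by rewrite -[2](rmorph_nat cst) fmorph_eq0 pnatr_eq0. Qed.

Lemma cst_i_sqr : cst 'i ^+ 2 = -1.
Proof. by rewrite -rmorphXn /= sqr_i rmorphN1. Qed.

Lemma rmorph_metric (A B : pzRingType) (f : {rmorphism A -> B}) mu :
  f (Defs.metric mu) = Defs.metric mu.
Proof. by rewrite /Defs.metric; case: ifP => _; rewrite ?rmorphN1 ?rmorph1. Qed.

(* The denominator is a polynomial in the loop momentum l, and it takes the
   value - m ^+ 2 at l = p. *)
Lemma loop_denominator_neq0 (E : C) (m : R) : m != 0 ->
  msq (ext_mom E \- loop_mom R) - cst (m ^+ 2)%:C != 0.
Proof.
move=> m0; pose e mu : C := if mu == ord0 :> 'I_4 then E else 0.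
pose P : mpoly.mpoly 4 C :=
  \sum_mu Defs.metric mu * (mpoly.mpolyC 4 (e mu)
     - mpoly.mpolyX C (mpoly.mnm1 mu)) ^+ 2 - mpoly.mpolyC 4 (m ^+ 2)%:C.
have -> : msq (ext_mom E \- loop_mom R) - cst (m ^+ 2)%:C = tofrac P.
  rewrite rmorphB rmorph_sum; congr (_ - _); apply: eq_bigr => mu _.
  rewrite rmorphM rmorphXn rmorphB /= rmorph_metric /ext_mom /e.
  by case: ifP => _; rewrite // !rmorph0.
rewrite tofrac_eq0; apply: contra_neq m0 => /(congr1 (mpoly.meval e)).
rewrite rmorph0 rmorphB rmorph_sum big1 => [|mu _].
  rewrite sub0r /= mpoly.mevalC => /eqP; rewrite oppr_eq0.
  by rewrite fmorph_eq0 sqrf_eq0 => /eqP.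
by rewrite rmorphM rmorphXn rmorphB /= mpoly.mevalC mpoly.mevalXU subrr expr0n mulr0.
Qed.

Variable gamma : 'I_4 -> 'M[C]_4.
Hypothesis gammaP : dirac_matrices gamma.
Local Notation g5 := (vertex (gamma5 gamma)).

Lemma vertexM A B : vertex (A *m B) = vertex A *m vertex B :> 'M[K]_4.
Proof. exact: map_mxM. Qed.

Lemma vertex_gamma5 :
  g5 = cst 'i *: \big[mulmx/1%:M]_(mu < 4) vertex (gamma mu).
Proof.
rewrite /vertex /gamma5 map_mxZ; congr (_ *: _).
by rewrite -/(vertex _) (big_morph _ vertexM (map_mx1 cst 4)).
Qed.

Lemma vertex_clifford mu nu :
  vertex (gamma mu) *m vertex (gamma nu) + vertex (gamma nu) *m vertex (gamma mu)
    = (if mu == nu then 2 * Defs.metric mu else 0)%:M :> 'M[K]_4.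
Proof.
rewrite -!vertexM /vertex -map_mxD gammaP map_scalar_mx; congr (_%:M).
by case: ifP => _; rewrite ?rmorph0 // rmorphM rmorph_nat /= rmorph_metric.
Qed.

Lemma slash_shell k (m : R) :
  (slash gamma k - (cst m%:C)%:M) *m (slash gamma k + (cst m%:C)%:M)
    = (msq k - cst (m ^+ 2)%:C)%:M.
Proof.
rewrite mulmxDl !mulmxDr !mulNmx mul_mx_scalar mul_scalar_mx.
rewrite /slash (slash_sqr integrand2_neq0 vertex_clifford) mul_scalar_mx scale_scalar_mx.
rewrite addrA addrK -raddfN -raddfD /=; congr (_%:M).
by rewrite /msq rmorphXn rmorphXn expr2.
Qed.

(** Since [invmx] returns a singular matrix unchanged, invertibility has to be established;
    [slash_shell] exhibits the inverse once the denominator is nonzero. *)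
Lemma propagatorE k (m : R) : msq k - cst (m ^+ 2)%:C != 0 ->
  propagator gamma k m
    = (msq k - cst (m ^+ 2)%:C)^-1 *: (slash gamma k + (cst m%:C)%:M).
Proof.
move=> D0; set D := msq k - _ in D0 *.
have AB : (slash gamma k - (cst m%:C)%:M) *m
   (D^-1 *: (slash gamma k + (cst m%:C)%:M)) = 1%:M.
  by rewrite -scalemxAr slash_shell scale_scalar_mx mulVf.
have [u _] := mulmx1_unit AB.
by rewrite /propagator -[LHS]mulmx1 -AB mulKmx.
Qed.

Lemma mxtrace_loop_momenta (k p : 'I_4 -> K) (m n a u b v : K) :
  \tr ((slash gamma k + m%:M) *m (a%:M + u *: g5) *m
       (slash gamma p + n%:M) *m (b%:M + v *: g5))
    = 4 * ((a * b - u * v) * (\sum_mu Defs.metric mu * (k mu * p mu))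
           + (a * b + u * v) * (m * n)).
Proof.
rewrite vertex_gamma5.
exact: (mxtrace_loop integrand2_neq0 cst_i_sqr vertex_clifford).
Qed.

End LoopReduction.

(** * Reduction to T and I *)

Section LoopChannel.
Local Open Scope complex_scope.
Variables (R : realType) (gamma : 'I_4 -> 'M[R[i]]_4) (X : njl R).
Local Notation C := R[i].
Local Notation K := (integrand R).
Local Notation cst := (@Defs.cst R).
Local Notation "'int' f" := (@loop_integral R X f) (at level 10, f at level 8).
Local Notation l := (@loop_mom R).
Local Notation S := (propagator gamma).
Local Notation g5 := (gamma5 gamma).

Hypothesis gammaP : dirac_matrices gamma.
Hypothesis int_linear :
  forall (a : C) f1 f2, int (cst a * f1 + f2) = a * int f1 + int f2.
Hypothesis int_shift : forall (m : R) (E : C),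
  loop_norm R * int ((msq (ext_mom E \- l) - cst (m ^+ 2)%:C)^-1) = Tint X m.

Lemma loop_integralZ a f : int (cst a * f) = a * int f.
Proof.
have i0 : int 0 = 0.
  have := int_linear 1 0 0; rewrite mulr0 addr0 mul1r => h.
  by apply: (addrI (int 0)); rewrite -h addr0.
by rewrite -[X in int X]addr0 int_linear i0 addr0.
Qed.

(** At zero energy [p - l] is [- l], so facts about the shifted denominator also cover the unshifted
    one. *)
Lemma msq_loop_mom0 : msq (ext_mom (0 : C) \- l) = msq l.
Proof.
by apply: eq_bigr => mu _; rewrite /ext_mom /= rmorph0 if_same sub0r sqrrN.
Qed.

Lemma loop_mom_dot (E : C) :
  2 * \sum_mu Defs.metric mu * (l mu * (ext_mom E \- l) mu)
    = cst (E ^+ 2) - msq l - msq (ext_mom E \- l).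
Proof.
have -> : cst (E ^+ 2) = msq (ext_mom E).
  rewrite /msq (bigD1 ord0) //= big1 => [|mu /negPf mu0].
    by rewrite /Defs.metric /ext_mom eqxx mul1r addr0 rmorphXn.
  by rewrite /ext_mom mu0 expr0n mulr0.
rewrite /msq mulr_sumr -!sumrB; apply: eq_bigr => mu _ /=.
move: (Defs.metric mu) (l mu) (ext_mom E mu) => e a b; ring.
Qed.

(** The numerator is expanded in the denominators [D1 - p] and [D2 - q]: each cancelled denominator
    leaves a tadpole, and the constant remainder multiplies the integrand of I. *)
Lemma loop_partial_fractions (F : fieldType) (D1 D2 d e p q x y m n : F) :
  2 != 0 :> F -> D1 - p != 0 -> D2 - q != 0 -> 2 * d = e - D1 - D2 ->
  (D1 - p)^-1 * ((D2 - q)^-1 * (4 * (x * d + y * (m * n))))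
  = (2 * x * (e - p - q) + 4 * y * (m * n)) * ((D1 - p) * (D2 - q))^-1
    + ((- 2 * x) * (D1 - p)^-1 + (- 2 * x) * (D2 - q)^-1).
Proof.
move=> F2 D1p D2q dE.
have -> : 4 * (x * d + y * (m * n)) = 2 * (x * (e - D1 - D2) + 2 * y * (m * n)).
  by rewrite -dE; ring.
by field; rewrite D1p D2q.
Qed.

Lemma vertex_linear (a u : C) :
  vertex (a%:M + u *: g5) = (cst a)%:M + cst u *: vertex g5.
Proof. by rewrite /vertex map_mxD map_scalar_mx map_mxZ. Qed.

Lemma mxtrace_loop_scale n (A B V W : 'M[K]_n) (a b : K) :
  \tr ((a *: A) *m V *m (b *: B) *m W) = a * (b * \tr (A *m V *m B *m W)).
Proof. by rewrite -!scalemxAl -scalemxAr -scalemxAl !mxtraceZ. Qed.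

(** All polarization operators are instances: [(a, u, b, v)] is [(1, 0, 1, 0)] for the scalar,
    [(0, 'i, 0, 'i)] for the pseudoscalar, and [a = b = 1] with [u], [v] equal to 1 or -1 for the
    chiral entries of mixed channels. *)
Lemma loop_channel (m1 m2 : R) (E a u b v : C) : m1 != 0 -> m2 != 0 ->
  loop_norm R * int (\tr (S l m1 *m vertex (a%:M + u *: g5) *m
                          S (ext_mom E \- l) m2 *m vertex (b%:M + v *: g5)))
  = 2 * (a * b - u * v) *
      ((E ^+ 2 - m1%:C ^+ 2 - m2%:C ^+ 2) * Iint X m1 m2 E - Tint X m1 - Tint X m2)
    + 4 * (a * b + u * v) * (m1%:C * m2%:C) * Iint X m1 m2 E.
Proof.
move=> m10 m20.
have D1 := loop_denominator_neq0 0 m10; rewrite msq_loop_mom0 in D1.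
have D2 := loop_denominator_neq0 E m20.
rewrite !propagatorE // mxtrace_loop_scale !vertex_linear mxtrace_loop_momenta //.
rewrite (loop_partial_fractions _ _ _ _ (@integrand2_neq0 R) D1 D2 (loop_mom_dot E)).
set x := a * b - u * v; set y := a * b + u * v.
rewrite -!(rmorphM cst a, rmorphM cst u) -rmorphB -rmorphD /= -/x -/y.
have -> : 2 * cst x * (cst (E ^+ 2) - cst (m1 ^+ 2)%:C - cst (m2 ^+ 2)%:C)
    + 4 * cst y * (cst m1%:C * cst m2%:C)
  = cst (2 * x * (E ^+ 2 - m1%:C ^+ 2 - m2%:C ^+ 2) + 4 * y * (m1%:C * m2%:C)).
  rewrite ![in LHS]rmorphXn /=; move: x y m1%:C m2%:C => x y c1 c2.
  by rewrite rmorphD !rmorphM !rmorphB !rmorph_nat !rmorphXn.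
have -> : - 2 * cst x = cst (- 2 * x) by rewrite rmorphM rmorphN rmorph_nat.
rewrite int_linear int_linear loop_integralZ.
rewrite -(int_shift m2 E) /Tint /Iint; ring.
Qed.

End LoopChannel.

(** Serves for the difference of two tadpoles; the right side has the shape that the linearity rule
    of the integral accepts. *)
Lemma subr_inv_fractions (F : fieldType) (k a b : F) :
  k - a != 0 -> k - b != 0 ->
  (a - b) / ((k - a) * (k - b)) = -1 * (k - b)^-1 + (k - a)^-1.
Proof. by move=> ka kb; field; rewrite ka kb. Qed.

(** * Dispersion functions in closed form *)

Section DispersionFunctions.
Local Open Scope complex_scope.
Variables (R : realType) (gamma : 'I_4 -> 'M[R[i]]_4).
Variables (M : quark -> R) (X : njl R).
Local Notation C := R[i].
Local Notation K := (integrand R).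
Local Notation cst := (@Defs.cst R).
Local Notation "'int' f" := (@loop_integral R X f) (at level 10, f at level 8).
Local Notation l := (@loop_mom R).
Local Notation y := (Defs.y X).

Hypotheses (gammaP : dirac_matrices gamma) (M_gt0 : forall q, 0 < M q).
Hypothesis X_vacuum : vacuum M X.

Lemma mass_neq0 q : M q != 0. Proof. by rewrite gt_eqF. Qed.

Lemma loop_prefactor (r k : R) (f : K) :
  - ('i * r%:C / (k%:C * ((2 * pi) ^+ 4)%:C)) * int f
    = - (r%:C / k%:C) * (loop_norm R * int f).
Proof. by rewrite /loop_norm invfM; ring. Qed.

(** The antiquark line carries the mass [- M q]. T and I see only its square; the sign survives in
    the product of masses in [loop_channel], where it decides which of the two parities is
    massless. *)
Lemma TintN m : Tint X (- m) = Tint X m. Proof. by rewrite /Tint sqrrN. Qed.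

Lemma IintN m1 m2 E : Iint X m1 (- m2) E = Iint X m1 m2 E.
Proof. by rewrite /Iint sqrrN. Qed.

Lemma natC n : n%:R = (n%:R : R)%:C :> C. Proof. by rewrite rmorph_nat. Qed.

Lemma disp_SE q E :
  disp_S gamma M X q E
    = (y q q ^+ 2)%:C * (E ^+ 2 - ((2 * M q) ^+ 2)%:C) * Iint X (M q) (M q) E.
Proof.
case: X_vacuum => _ [lin shift _] /(_ q) gap.
have m0 := mass_neq0 q; have m0' : - M q != 0 by rewrite oppr_eq0.
have := loop_channel gammaP lin shift E 1 0 1 0 m0 m0'.
rewrite !scale0r !addr0 /vertex !map_mx1 !mulmx1 TintN IintN => h.
rewrite /disp_S /Pi_S gap natC loop_prefactor h rmorphN rmorphXn rmorphM !rmorph_nat.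
rewrite !rmorphXn /=.
by field.
Qed.

Lemma disp_PE q E :
  disp_P gamma M X q E = (y q q ^+ 2)%:C * E ^+ 2 * Iint X (M q) (M q) E.
Proof.
case: X_vacuum => _ [lin shift _] /(_ q) gap.
have m0 := mass_neq0 q; have m0' : - M q != 0 by rewrite oppr_eq0.
have := loop_channel gammaP lin shift E 0 'i 0 'i m0 m0'.
rewrite !raddf0 !add0r TintN IintN -!expr2 sqr_i expr0n => h.
(* Cyclicity of the trace moves the leading vertex to the end, as in [loop_channel]. *)
rewrite /disp_P /Pi_P gap natC loop_prefactor -!mulmxA mxtrace_mulC !mulmxA h.
rewrite rmorphN !rmorph_nat !rmorphXn /=.
by field.
Qed.

Lemma mixed_diagE b q1 q2 E :
  mixed_diag gamma M X b q1 q2 E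
    = - (y q1 q2 ^+ 2)%:C *
      ((E ^+ 2 - (M q1 ^+ 2 + M q2 ^+ 2)%:C) * Iint X (M q1) (M q2) E
       - Tint X (M q1) - Tint X (M q2)).
Proof.
case: X_vacuum => _ [lin shift _] _.
rewrite /mixed_diag /chiral natC loop_prefactor.
rewrite (loop_channel gammaP lin shift) ?mass_neq0 //.
(* Opposite chiralities have [u * v = -1], which removes the mass term. *)
have -> : ((-1) ^+ b * (-1) ^+ (~~ b))%R = -1 :> C by case: b; rewrite ?mulr1 ?mul1r.
rewrite -natC rmorphD !rmorphXn /=.
by field.
Qed.

Lemma mixed_offE b q1 q2 E :
  mixed_off gamma M X b q1 q2 E
    = - (2 * y q1 q2 * y q2 q1 * M q1 * M q2)%:C * Iint X (M q1) (M q2) E.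
Proof.
case: X_vacuum => _ [lin shift _] _.
rewrite /mixed_off /chiral natC loop_prefactor.
rewrite (loop_channel gammaP lin shift) ?mass_neq0 //.
(* Equal chiralities have [u * v = 1], which leaves only the mass term, whatever the sign [b]. *)
rewrite -!expr2 sqrr_sign expr1n -natC !rmorphM rmorph_nat /=.
by field.
Qed.

(** At zero energy both denominators of I contain the same [msq l], so I splits into two tadpoles by
    partial fractions. *)
Lemma Tint_sub m1 m2 : m1 != 0 -> m2 != 0 ->
  Tint X m1 - Tint X m2 = (m1 ^+ 2 - m2 ^+ 2)%:C * Iint X m1 m2 0.
Proof.
move=> m10 m20; case: X_vacuum => _ [lin shift _] _.
have D1 := loop_denominator_neq0 0 m10; have D2 := loop_denominator_neq0 0 m20.
rewrite msq_loop_mom0 in D1 D2.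
rewrite /Tint /Iint msq_loop_mom0 mulrCA -(loop_integralZ lin (m1 ^+ 2 - m2 ^+ 2)%:C).
have -> : cst (m1 ^+ 2 - m2 ^+ 2)%:C
     / ((msq l - cst (m1 ^+ 2)%:C) * (msq l - cst (m2 ^+ 2)%:C))
   = cst (-1) * (msq l - cst (m2 ^+ 2)%:C)^-1 + (msq l - cst (m1 ^+ 2)%:C)^-1.
  rewrite rmorphB /= (rmorphB cst).
  by rewrite (subr_inv_fractions D1 D2) (rmorphN1 cst).
by rewrite lin; ring.
Qed.

(** The rule for I provides a separate constant for each ordering of the quarks. Both constants
    express the same tadpole difference, with a nonzero coefficient, so they agree. *)
Lemma IintC q1 q2 : M q1 ^+ 2 != M q2 ^+ 2 ->
  forall E, Iint X (M q2) (M q1) E = Iint X (M q1) (M q2) E.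
Proof.
move=> M12 E; case: X_vacuum => _ [_ _ cI] _.
have [c _ cE] := cI q1 q2; have [c' _ c'E] := cI q2 q1.
have h := Tint_sub (mass_neq0 q1) (mass_neq0 q2).
have h' := Tint_sub (mass_neq0 q2) (mass_neq0 q1).
have : Tint X (M q1) - Tint X (M q2) = - (Tint X (M q2) - Tint X (M q1)).
  by rewrite opprB.
rewrite h h' -[M q2 ^+ 2 - _]opprB rmorphN mulNr opprK !cE !c'E.
by move=> /mulfI -> //; rewrite fmorph_eq0 subr_eq0.
Qed.

(** Each gap equation gives its tadpole as a multiple of [1 / (2 * y q q ^+ 2)], which is exactly
    what [is_zeta] averages. *)
Lemma inv_gNC_zeta q1 q2 z : (forall q q', y q q' != 0) -> is_zeta X q1 q2 z ->
  inv_gNC X = (y q1 q2 ^+ 2)%:C *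
    ((1 + z)%:C * Tint X (M q1) + (1 - z)%:C * Tint X (M q2)).
Proof.
move=> y0 zP; case: X_vacuum => _ _ gap.
have Y0 q q' : (y q q' ^+ 2)%:C != 0 by rewrite fmorph_eq0 sqrf_eq0.
have T q : Tint X (M q) = inv_gNC X * ((1 / (2 * y q q ^+ 2))%:C).
  rewrite (gap q) div1r fmorphV (rmorphM _ 2) /= -natC invfM.
  by move: (y q q ^+ 2)%:C (Y0 q q) => Y Yn; field.
have -> : (1 + z)%:C * Tint X (M q1) + (1 - z)%:C * Tint X (M q2)
    = inv_gNC X * ((1 + z) / (2 * y q1 q1 ^+ 2) + (1 - z) / (2 * y q2 q2 ^+ 2))%:C.
  move: (1 + z) (1 - z) => a b.
  by rewrite !T !div1r rmorphD (rmorphM _ a) (rmorphM _ b) /=; ring.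
by rewrite -zP div1r fmorphV /= mulrCA mulfV ?mulr1.
Qed.

Lemma det_mx2 (A : 'M[C]_2) :
  \det A = A ord0 ord0 * A ord_max ord_max - A ord0 ord_max * A ord_max ord0.
Proof.
rewrite (expand_det_row _ ord0) !big_ord_recl big_ord0 addr0 /cofactor !det_mx11.
rewrite !mxE /= expr0 expr1 mul1r mulN1r mulrN.
have -> : lift ord0 0 = ord_max :> 'I_2 by exact: val_inj.
have -> : lift ord_max 0 = ord0 :> 'I_2 by exact: val_inj.
by [].
Qed.

Lemma disp_mixedE sgn q1 q2 (z12 z21 : R) E :
  M q1 ^+ 2 != M q2 ^+ 2 ->
  (forall q q', y q q' != 0) -> is_zeta X q1 q2 z12 -> is_zeta X q2 q1 z21 ->
  let D := M q1 ^+ 2 - M q2 ^+ 2 in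
  let w := E ^+ 2 - (M q1 ^+ 2 + M q2 ^+ 2)%:C in
  disp_mixed gamma M X sgn q1 q2 E
    = ((y q1 q2 * y q2 q1)%:C * Iint X (M q1) (M q2) E) ^+ 2 *
      ((w + (z12 * D)%:C) * (w - (z21 * D)%:C) - (4 * M q1 ^+ 2 * M q2 ^+ 2)%:C).
Proof.
move=> M12 y0 z12P z21P D w.
(* [Tint_sub] involves I at zero energy; independence of [p] carries it to [E]. *)
have T12 : Tint X (M q1) = D%:C * Iint X (M q1) (M q2) E + Tint X (M q2).
  case: X_vacuum => _ [_ _ cI] _; have [c _ cE] := cI q1 q2.
  apply/eqP; rewrite -subr_eq; apply/eqP.
  by rewrite (Tint_sub (mass_neq0 q1) (mass_neq0 q2)) !cE.
(* The sum of tadpoles cancels against the gap equation, leaving [z12] times their difference, a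
   multiple of I. *)
have d1 : inv_gNC X - mixed_diag gamma M X (sgn ord0 ord0) q1 q2 E
  = (y q1 q2 ^+ 2)%:C * Iint X (M q1) (M q2) E * (w + (z12 * D)%:C).
  rewrite mixed_diagE (inv_gNC_zeta y0 z12P) -/w T12 !(rmorphD, rmorphM, rmorphB) rmorph1.
  by ring.
have d2 : inv_gNC X - mixed_diag gamma M X (sgn ord_max ord_max) q2 q1 E
  = (y q2 q1 ^+ 2)%:C * Iint X (M q1) (M q2) E * (w - (z21 * D)%:C).
  rewrite mixed_diagE (inv_gNC_zeta y0 z21P) [M q2 ^+ 2 + _]addrC -/w IintC //.
  rewrite T12 !(rmorphD, rmorphM, rmorphB) rmorph1.
  by ring.
rewrite /disp_mixed det_mx2 !mxE /= !mixed_offE.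
rewrite [X in X * _]d1 [X in _ * X - _]d2.
rewrite !(rmorphM, rmorphXn) !rmorph_nat /=.
by ring.
Qed.
End DispersionFunctions.

(** * Leading order in the delta y *)

Section Asymptotics.
Variables (R : realType) (X : R -> njl R) (dy : quark -> quark -> R).
Hypothesis X_dy :
  forall q1 q2, (y (X e) q1 q2 - 1) / e @[e --> 0^'+] --> dy q1 q2.

Lemma cvg_right_id : e @[e --> (0 : R)^'+] --> (0 : R).
Proof. by apply: cvg_at_right_filter; exact: cvg_id. Qed.

Lemma coupling_cvg q1 q2 : y (X e) q1 q2 @[e --> 0^'+] --> (1 : R).
Proof.
have h : 1 + e * ((y (X e) q1 q2 - 1) / e) @[e --> 0^'+] --> 1 + 0 * dy q1 q2.
  by apply: cvgD; [exact: cvg_cst | apply: cvgM => //; exact: cvg_right_id].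
rewrite mul0r addr0 in h.
apply: cvg_trans h; apply: near_eq_cvg; near=> e.
have e0 : 0 < e by near: e; exact: nbhs_right_gt.
by rewrite /= mulrCA mulfV ?gt_eqF // mulr1 addrC subrK.
Unshelve. all: by end_near. Qed.

Lemma coupling_neq0 : \forall e \near 0^'+, forall q q', y (X e) q q' != 0.
Proof.
(* There are finitely many quarks, so the neighbourhoods can be intersected. *)
apply: filter_forall => q; apply: filter_forall => q'.
by apply: (cvgr_neq0 _ (coupling_cvg q q')); exact: oner_neq0.
Qed.

(* The factorization gives y12 y21 = y11 y22; this is its first order. *)
Lemma dy_sum q1 q2 : dy q1 q2 + dy q2 q1 = dy q1 q1 + dy q2 q2.
Proof.
pose t q q' e := (y (X e) q q' - 1) / e.
(* With [y = 1 + e * t], the expression is [(y1 * y2 - 1) / e] for the two couplings, so it depends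
   only on their product. *)
have cv a b c d : t a b e + t c d e + e * (t a b e * t c d e) @[e --> 0^'+]
    --> dy a b + dy c d.
  have tc q q' : t q q' e @[e --> 0^'+] --> dy q q' by exact: X_dy.
  have h : t a b e + t c d e + e * (t a b e * t c d e) @[e --> 0^'+]
      --> dy a b + dy c d + 0 * (dy a b * dy c d).
    apply: cvgD; first exact: cvgD.
    by apply: cvgM; [exact: cvg_right_id | exact: cvgM].
  by rewrite mul0r addr0 in h.
have h : t q1 q1 e + t q2 q2 e + e * (t q1 q1 e * t q2 q2 e) @[e --> 0^'+]
    --> dy q1 q2 + dy q2 q1.
  apply: cvg_trans (cv q1 q2 q2 q1); apply: near_eq_cvg; near=> e.
  have e0 : e != 0 by rewrite gt_eqF //; near: e; exact: nbhs_right_gt.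
  by rewrite /t /y; field.
exact: (norm_cvg_unique h (cv q1 q1 q2 q2)).
Unshelve. all: by end_near. Qed.

(** The difference quotient factors as [- (y + 1) / y ^+ 2] times that of [y]; the first factor
    tends to -2. *)
Lemma inv_sqr_coupling_cvg q1 q2 :
  (1 / y (X e) q1 q2 ^+ 2 - 1) / e @[e --> 0^'+] --> - 2 * dy q1 q2.
Proof.
have yc := coupling_cvg q1 q2.
have h : - (y (X e) q1 q2 + 1) / y (X e) q1 q2 ^+ 2 * ((y (X e) q1 q2 - 1) / e)
    @[e --> 0^'+] --> - (1 + 1) / 1 ^+ 2 * dy q1 q2.
  apply: cvgM; last exact: X_dy.
  apply: cvgM.
    by apply: cvgN; apply: cvgD => //; exact: cvg_cst.
  apply: cvgV; first by rewrite expr1n oner_neq0.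
  by apply: cvgM.
rewrite expr1n divr1 in h.
apply: cvg_trans h; apply: near_eq_cvg; near=> e.
have e0 : e != 0 by rewrite gt_eqF //; near: e; exact: nbhs_right_gt.
have y0 : y (X e) q1 q2 != 0 by near: e; apply: (cvgr_neq0 _ yc); exact: oner_neq0.
by field; rewrite y0 e0.
Unshelve. all: by end_near. Qed.

(** The equation [is_zeta] is affine in zeta. In the difference quotients [u] of [1 / y ^+ 2] it
    exhibits zeta as a ratio whose denominator has a nonzero limit, and the factors -2 cancel. *)
Lemma zeta_cvg (zeta : R -> R) q1 q2 : dy q1 q1 != dy q2 q2 ->
  (\forall e \near 0^'+, is_zeta (X e) q1 q2 (zeta e)) ->
  zeta e @[e --> 0^'+] --> zeta_lead dy q1 q2.
Proof.
move=> dy12 zP; pose u q q' e := (1 / y (X e) q q' ^+ 2 - 1) / e.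
have uc q q' : u q q' e @[e --> 0^'+] --> - 2 * dy q q'.
  exact: inv_sqr_coupling_cvg.
have dc : u q1 q1 e - u q2 q2 e @[e --> 0^'+] --> - 2 * dy q1 q1 - (- 2 * dy q2 q2).
  by apply: cvgB.
have d0 : - 2 * dy q1 q1 - (- 2 * dy q2 q2) != 0.
  by rewrite -mulrBr mulf_neq0 ?subr_eq0 // oppr_eq0 pnatr_eq0.
have h : (2 * u q1 q2 e - u q2 q2 e - u q1 q1 e) / (u q1 q1 e - u q2 q2 e)
   @[e --> 0^'+] --> (2 * (- 2 * dy q1 q2) - (- 2 * dy q2 q2) - (- 2 * dy q1 q1))
                     / (- 2 * dy q1 q1 - (- 2 * dy q2 q2)).
  apply: cvgM; last exact: cvgV.
  by apply: cvgB => //; apply: cvgB => //; apply: cvgM => //; exact: cvg_cst.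
have -> : zeta_lead dy q1 q2
  = (2 * (- 2 * dy q1 q2) - (- 2 * dy q2 q2) - (- 2 * dy q1 q1))
                     / (- 2 * dy q1 q1 - (- 2 * dy q2 q2)).
  rewrite /zeta_lead -!mulrBr; field.
  by rewrite -mulrBr in d0; rewrite subr_eq0 dy12.
apply: cvg_trans h; apply: near_eq_cvg; near=> e.
have e0 : e != 0 by rewrite gt_eqF //; near: e; exact: nbhs_right_gt.
have ud : u q1 q1 e - u q2 q2 e != 0 by near: e; exact: (cvgr_neq0 _ dc d0).
have ze : is_zeta (X e) q1 q2 (zeta e) by near: e.
suff -> : 2 * u q1 q2 e - u q2 q2 e - u q1 q1 e = zeta e * (u q1 q1 e - u q2 q2 e).
  by rewrite mulfK.
have y0 : forall q q', y (X e) q q' != 0 by near: e; exact: coupling_neq0.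
rewrite /u ze; have := y0 q1 q1; have := y0 q2 q2.
move: (y _ q1 q1) (y _ q2 q2) => a b b0 a0.
by field; rewrite a0 b0 e0.
Unshelve. all: by end_near. Qed.

(** By [dy_sum], exchanging the quarks negates both numerator and denominator. *)
Lemma zeta_leadC q1 q2 : dy q1 q1 != dy q2 q2 ->
  zeta_lead dy q1 q2 = zeta_lead dy q2 q1.
Proof.
move=> dy12; rewrite /zeta_lead; have -> : dy q2 q1 = dy q1 q1 + dy q2 q2 - dy q1 q2.
  by rewrite -dy_sum addrAC subrr add0r.
have d12 : dy q1 q1 - dy q2 q2 != 0 by rewrite subr_eq0.
have d21 : dy q2 q2 - dy q1 q1 != 0 by rewrite subr_eq0 eq_sym.
by field; rewrite d12 d21.
Qed.

End Asymptotics.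

(** * Spectra *)

Section Spectrum.
Local Open Scope complex_scope.
Variable R : realType.
Local Notation C := R[i].

(** The two zetas are kept apart because only their limits are identified. The value [false] of [b]
    selects the plus sign. *)
Definition mixed_root (m1 m2 z12 z21 : R) (b : bool) : R :=
  m1 ^+ 2 + m2 ^+ 2 - (z12 - z21) / 2 * (m1 ^+ 2 - m2 ^+ 2)
  + (-1) ^+ b * Num.sqrt (((z12 + z21) / 2 * (m1 ^+ 2 - m2 ^+ 2)) ^+ 2
                          + 4 * m1 ^+ 2 * m2 ^+ 2).

Lemma mixed_rootP (m1 m2 z12 z21 : R) (E : C) :
  let D := m1 ^+ 2 - m2 ^+ 2 in
  let w := E ^+ 2 - (m1 ^+ 2 + m2 ^+ 2)%:C in
  (w + (z12 * D)%:C) * (w - (z21 * D)%:C) - (4 * m1 ^+ 2 * m2 ^+ 2)%:C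
    = (E ^+ 2 - (mixed_root m1 m2 z12 z21 false)%:C)
      * (E ^+ 2 - (mixed_root m1 m2 z12 z21 true)%:C).
Proof.
move=> D w; rewrite /mixed_root expr0 expr1 mul1r mulN1r -/D.
(* In the half-difference [c] and half-sum [d] the product becomes
   [(w + c * D) ^+ 2 - (d * D) ^+ 2], a difference of squares. *)
set c := (z12 - z21) / 2; set d := (z12 + z21) / 2.
have -> : z12 = d + c by rewrite /d /c; field.
have -> : z21 = d - c by rewrite /d /c; field.
set m := 4 * _ * _; have m0 : 0 <= m.
  by apply: mulr_ge0; [apply: mulr_ge0 |]; rewrite ?sqr_ge0.
have : Num.sqrt ((d * D) ^+ 2 + m) ^+ 2 = (d * D) ^+ 2 + m.
  by rewrite sqr_sqrtr // addr_ge0 ?sqr_ge0.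
move: (Num.sqrt _) => r rE.
have -> : m = r ^+ 2 - (d * D) ^+ 2 by rewrite rE addrAC subrr add0r.
rewrite /w; move: (m1 ^+ 2 + m2 ^+ 2) => s.
rewrite (mulrDl d c) (mulrBl D d c); move: (c * D) (d * D) => p q.
rewrite !(rmorphB, rmorphD, rmorphXn) /=.
by ring.
Qed.

(** Positive squared masses make the radicand positive, so the two signs give different roots. *)
Lemma mixed_root_inj (m1 m2 z12 z21 : R) : m1 != 0 -> m2 != 0 ->
  injective (mixed_root m1 m2 z12 z21).
Proof.
move=> m10 m20; rewrite /mixed_root => b b' /addrI.
set r := Num.sqrt _; have r0 : r != 0.
  rewrite gt_eqF // sqrtr_gt0 ltr_wpDl ?sqr_ge0 //.
  by apply: mulr_gt0; [apply: mulr_gt0 |]; rewrite ?exprn_even_gt0.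
by move/(mulIf r0); case: b b' => [] [] //=; rewrite expr0 expr1; lra.
Qed.

Lemma mixed_root_cvg (m1 m2 z : R) (z12 z21 : R -> R) b :
  z12 e @[e --> 0^'+] --> z -> z21 e @[e --> 0^'+] --> z ->
  mixed_root m1 m2 (z12 e) (z21 e) b @[e --> 0^'+]
    --> m1 ^+ 2 + m2 ^+ 2 + (-1) ^+ b *
        Num.sqrt ((m2 ^+ 2 - m1 ^+ 2) ^+ 2 * z ^+ 2 + 4 * m1 ^+ 2 * m2 ^+ 2).
Proof.
move=> c12 c21; set D := m1 ^+ 2 - m2 ^+ 2.
(* The target is put in the form of [mixed_root] with both zetas equal to [z], so that limits pass
   term by term. *)
have -> : (m2 ^+ 2 - m1 ^+ 2) ^+ 2 * z ^+ 2 = ((z + z) / 2 * D) * ((z + z) / 2 * D).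
  by rewrite /D; field.
have -> : m1 ^+ 2 + m2 ^+ 2 = m1 ^+ 2 + m2 ^+ 2 - (z - z) / 2 * D.
  by rewrite subrr !mul0r subr0.
apply: cvgD.
  apply: cvgB; first exact: cvg_cst.
  apply: cvgM; last exact: cvg_cst.
  by apply: cvgM; [exact: cvgB | exact: cvg_cst].
apply: cvgM; first exact: cvg_cst.
apply: (continuous_cvg _ (@sqrt_continuous R _)).
apply: cvgD; last exact: cvg_cst.
by apply: cvgM; (apply: cvgM; last exact: cvg_cst);
  (apply: cvgM; last exact: cvg_cst); exact: cvgD.
Qed.

(** The sum rule concerns any admissible list [s]. For small [e] its family and the known one
    enumerate the same roots without repetition, so the sums agree before the limit and hence in
    it. *)
Lemma leading_roots_sum (D : R -> C -> C) (s : seq R)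
    (x : bool -> R -> R) (a : bool -> R) :
  (\forall e \near 0^'+, injective (x^~ e) /\
     forall E : C, D e E = 0 <-> exists b, E ^+ 2 = (x b e)%:C) ->
  (forall b, x b e @[e --> 0^'+] --> a b) ->
  leading_roots D s -> \sum_(r <- s) r = a false + a true.
Proof.
move=> xP xa [x' x'P x's].
have s1 : \sum_i x' i e @[e --> 0^'+] --> \sum_(i < size s) s`_i.
  by apply: cvg_big => [|i _]; [exact: add_continuous | exact: x's].
have s2 : x false e + x true e @[e --> 0^'+] --> a false + a true by exact: cvgD.
rewrite (big_nth 0) big_mkord; apply: (norm_cvg_unique _ s2).
apply: cvg_trans s1; apply: near_eq_cvg; near=> e.
have [xi xD] : injective (x^~ e) /\
     forall E : C, D e E = 0 <-> exists b, E ^+ 2 = (x b e)%:C by near: e.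
have [x'i x'D] : injective (x'^~ e) /\
     forall E : C, D e E = 0 <-> exists i, E ^+ 2 = (x' i e)%:C by near: e.
have e1 : perm_eq [seq x' i e | i <- index_enum 'I_(size s)]
                  [seq x b e | b <- index_enum bool].
  apply: uniq_perm; rewrite ?map_inj_uniq ?index_enum_uniq // => r.
  apply/mapP/mapP => -[j _ ->].
    (* Energies are complex, so every real value of [E ^+ 2], even negative, is attained by a square
       root. *)
    have /xD[b] : D e (sqrtc (x' j e)%:C) = 0 by apply/x'D; exists j; rewrite sqr_sqrtc.
    by rewrite sqr_sqrtc => /complexI ->; exists b; rewrite ?mem_index_enum.
  have /x'D [k] : D e (sqrtc (x j e)%:C) = 0 by apply/xD; exists j; rewrite sqr_sqrtc.
  by rewrite sqr_sqrtc => /complexI ->; exists k; rewrite ?mem_index_enum.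
have := perm_big _ e1 : \sum_(r <- _) r = \sum_(r <- _) r.
by rewrite !big_map big_bool addrC.
Unshelve. all: by end_near. Qed.

Lemma has_mass_uniq (D : C -> C) (m m' : R) : has_mass D m -> has_mass D m' -> m = m'.
Proof.
move=> [m0 mP] [m'0 m'P]; have : (m%:C) ^+ 2 = (m' ^+ 2)%:C.
  by apply/m'P/mP; rewrite rmorphXn.
by rewrite -rmorphXn => /complexI /eqP; rewrite eqrXn2 // => /eqP.
Qed.

End Spectrum.

(** * Zeros of the dispersion functions in a fixed vacuum *)

Section Masses.
Variables (R : realType) (gamma : 'I_4 -> 'M[R[i]]_4).
Variables (M : quark -> R) (X : njl R).
Hypotheses (gammaP : dirac_matrices gamma) (M_gt0 : forall q, 0 < M q).
Hypotheses (X_vacuum : vacuum M X) (y_neq0 : forall q q', y X q q' != 0).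

Lemma Iint_neq0 q1 q2 E : Iint X (M q1) (M q2) E != 0.
Proof. by case: X_vacuum => _ [_ _ /(_ q1 q2)[c c0 ->]]. Qed.

Lemma has_mass_P q : has_mass (disp_P gamma M X q) 0.
Proof.
split=> // E; rewrite disp_PE // expr0n rmorph0.
split=> [/eqP|->]; last by rewrite mulr0 mul0r.
rewrite mulf_eq0 (negPf (Iint_neq0 _ _ _)) orbF mulf_eq0 fmorph_eq0 sqrf_eq0.
by rewrite (negPf (y_neq0 _ _)) => /eqP.
Qed.

Lemma has_mass_S q : has_mass (disp_S gamma M X q) (2 * M q).
Proof.
split=> [|E]; first by rewrite mulr_ge0 // ltW.
rewrite disp_SE //; split=> [/eqP|->]; last by rewrite subrr mulr0 mul0r.
rewrite mulf_eq0 (negPf (Iint_neq0 _ _ _)) orbF mulf_eq0 fmorph_eq0 sqrf_eq0.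
by rewrite (negPf (y_neq0 _ _)) /= subr_eq0 => /eqP.
Qed.

Lemma disp_mixed_eq0 sgn q1 q2 z12 z21 : M q1 != M q2 ->
  is_zeta X q1 q2 z12 -> is_zeta X q2 q1 z21 ->
  forall E, disp_mixed gamma M X sgn q1 q2 E = 0 <->
    exists b, E ^+ 2 = (mixed_root (M q1) (M q2) z12 z21 b)%:C%C.
Proof.
move=> M12 z12P z21P E; have M2 : M q1 ^+ 2 != M q2 ^+ 2.
  by rewrite eqrXn2 // ltW.
rewrite (disp_mixedE gammaP M_gt0 X_vacuum sgn E M2 y_neq0 z12P z21P).
rewrite mixed_rootP; split=> [/eqP|[b ->]]; last first.
  by case: b; rewrite subrr ?mulr0 ?mul0r ?mulr0.
rewrite mulf_eq0 sqrf_eq0 mulf_eq0 fmorph_eq0 mulf_eq0.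
rewrite !(negPf (y_neq0 _ _)) (negPf (Iint_neq0 _ _ _)) /= mulf_eq0 !subr_eq0.
by case/orP=> /eqP ->; [exists false | exists true].
Qed.

End Masses.

Theorem mainTheorem3 (R : realType) (gamma : 'I_4 -> 'M[R[i]]_4)
    (sgn : 'I_2 -> 'I_2 -> bool)
    (M : quark -> R) (X : R -> njl R)
    (dy : quark -> quark -> R) (zeta : R -> quark -> quark -> R)
    (gammaP : dirac_matrices gamma)
    (M_gt0 : forall q, 0 < M q)
    (M_inj : injective M)
    (X_vacuum : \forall e \near 0^'+, vacuum M (X e))
    (X_dy : forall q1 q2, (y (X e) q1 q2 - 1) / e @[e --> 0^'+] --> dy q1 q2)
    (dy_inj : injective (fun q => dy q q))
    (zetaP : forall q1 q2, q1 <> q2 ->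
       \forall e \near 0^'+, is_zeta (X e) q1 q2 (zeta e q1 q2)) :
  [/\ (forall q : quark, \forall e \near 0^'+,
         has_mass (disp_P gamma M (X e) q) 0 /\
         has_mass (disp_S gamma M (X e) q) (2 * M q)),

      (forall q1 q2 : quark, q1 <> q2 ->
         let z := zeta_lead dy q1 q2 in
         let r := Num.sqrt ((M q2 ^+ 2 - M q1 ^+ 2) ^+ 2 * z ^+ 2
                            + 4 * M q1 ^+ 2 * M q2 ^+ 2) in
         [/\ zeta e q1 q2 @[e --> 0^'+] --> z,
             z = zeta_lead dy q2 q1
           & complex_excitations
               (fun e => disp_mixed gamma M (X e) sgn q1 q2)
               [:: M q1 ^+ 2 + M q2 ^+ 2 + r; M q1 ^+ 2 + M q2 ^+ 2 + r;
                   M q1 ^+ 2 + M q2 ^+ 2 - r; M q1 ^+ 2 + M q2 ^+ 2 - r]]),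

      (forall (q1 q2 : quark) (ms : seq R), q1 <> q2 ->
         complex_excitations
           (fun e => disp_mixed gamma M (X e) sgn q1 q2) ms ->
         \sum_(m2 <- ms) m2 = 4 * (M q1 ^+ 2 + M q2 ^+ 2))
    & (forall q : quark, \forall e \near 0^'+, forall mP mS : R,
         has_mass (disp_P gamma M (X e) q) mP ->
         has_mass (disp_S gamma M (X e) q) mS ->
         mP ^+ 2 + mS ^+ 2 = 4 * M q ^+ 2)].
Proof.
have y0 := coupling_neq0 X_dy.
have dy_neq q1 q2 : q1 <> q2 -> dy q1 q1 != dy q2 q2.
  by move=> q12; apply/eqP => /dy_inj.
pose x q1 q2 b e := mixed_root (M q1) (M q2) (zeta e q1 q2) (zeta e q2 q1) b.
have zc q1 q2 : q1 <> q2 -> zeta e q1 q2 @[e --> 0^'+] --> zeta_lead dy q1 q2.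
  by move=> q12; apply: (zeta_cvg X_dy (dy_neq _ _ q12)); exact: zetaP.
have xP q1 q2 : q1 <> q2 -> \forall e \near 0^'+, injective ((x q1 q2)^~ e) /\
    forall E, disp_mixed gamma M (X e) sgn q1 q2 E = 0 <->
      exists b, E ^+ 2 = (x q1 q2 b e)%:C%C.
  move=> q12; near=> e; split.
    by apply: mixed_root_inj; rewrite gt_eqF.
  have ve : vacuum M (X e) by near: e.
  have ye : forall q q', y (X e) q q' != 0 by near: e.
  have z12 : is_zeta (X e) q1 q2 (zeta e q1 q2) by near: e; exact: zetaP.
  have z21 : is_zeta (X e) q2 q1 (zeta e q2 q1) by near: e; apply: zetaP => /esym.
  by apply: disp_mixed_eq0 => //; apply/eqP => /M_inj.
pose r q1 q2 := Num.sqrt ((M q2 ^+ 2 - M q1 ^+ 2) ^+ 2 * zeta_lead dy q1 q2 ^+ 2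
                            + 4 * M q1 ^+ 2 * M q2 ^+ 2).
have xc q1 q2 b : q1 <> q2 ->
    x q1 q2 b e @[e --> 0^'+] --> M q1 ^+ 2 + M q2 ^+ 2 + (-1) ^+ b * r q1 q2.
  move=> q12; apply: mixed_root_cvg; first exact: zc.
  (* The zeta of the exchanged pair tends to the same limit by symmetry. *)
  by rewrite (zeta_leadC X_dy (dy_neq _ _ q12)); apply: zc => /esym.
split.
- move=> q; near=> e.
  have ve : vacuum M (X e) by near: e.
  have ye : forall q q', y (X e) q q' != 0 by near: e.
  by split; [exact: has_mass_P | exact: has_mass_S].
- move=> q1 q2 q12 z r0; split; [exact: zc | exact: zeta_leadC (dy_neq _ _ q12) |].
  (* Each limit is listed once; the double degeneracy comes from [s ++ s]. *)
  exists [:: M q1 ^+ 2 + M q2 ^+ 2 + r0; M q1 ^+ 2 + M q2 ^+ 2 - r0]; last first.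
    rewrite /= perm_cons; apply/permPl.
    exact: (perm_catCA [:: _] [:: _] [:: _]).
  (* Positions in the list correspond to signs: index 0 to plus, index 1 to minus. *)
  pose bo (i : 'I_2) := i == ord_max.
  have bo_inj : injective bo.
    by move=> [[|[|//]] h] [[|[|//]] h'] // _; exact: val_inj.
  exists (fun i => x q1 q2 (bo i)).
    near=> e.
    have [xi xD] : injective ((x q1 q2)^~ e) /\
      forall E, disp_mixed gamma M (X e) sgn q1 q2 E = 0 <->
        exists b, E ^+ 2 = (x q1 q2 b e)%:C%C by near: e; exact: xP.
    split=> [i j /xi /bo_inj // | E]; rewrite xD; split=> -[b Eb]; last by exists (bo b).
    by exists (if b then ord_max else ord0); rewrite Eb; case: b {Eb}.
  move=> i; rewrite (_ : _`_i = M q1 ^+ 2 + M q2 ^+ 2 + (-1) ^+ bo i * r q1 q2).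
    exact: xc.
  by case: i => [[|[|//]] h]; rewrite /bo -val_eqE /= ?expr0 ?expr1 ?mul1r ?mulN1r.
- move=> q1 q2 ms q12 [s sP mss]; rewrite (perm_big _ mss) big_cat /=.
  rewrite (leading_roots_sum (xP _ _ q12) (fun b => xc _ _ b q12) sP).
  by rewrite expr0 expr1; ring.
- move=> q; near=> e => mP mS.
  have ve : vacuum M (X e) by near: e.
  have ye : forall q q', y (X e) q q' != 0 by near: e.
  move=> /(has_mass_uniq (has_mass_P gammaP M_gt0 ve ye q)) <-.
  move=> /(has_mass_uniq (has_mass_S gammaP M_gt0 ve ye q)) <-.
  by ring.
Unshelve. all: by end_near. Qed.
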